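(* Let $\mu$ be a nonnegative Borel measure on $\mathbb{R}^+$ with $\mu(\mathbb{R}^+)\in(0,\infty)$, let $f\in C(\mathbb{R};\mathbb{R})$, let $h\in L^1_{loc}(\mathbb{R}^+;\mathbb{R})$, $H(t):=\int_0^t h(s)\,ds$, and let $\psi\in\mathbb{R}$. Suppose there is $\phi\in C^1(\mathbb{R}^+;(0,\infty))$ with $\phi'(x)>0$ for all $x\ge0$, $\lim_{x\to\infty}\phi(x)=\infty$, $\phi'$ non-increasing with $\lim_{x\to\infty}\phi'(x)=0$, and such that $$\lim_{x\to\infty}\frac{f(x)}{\phi(x)}=1,\qquad \lim_{|x|\to\infty}\frac{|f(x)|}{\phi(|x|)}=1.$$ Suppose there are increasing functions $\gamma_+,\gamma_-\in C((0,\infty);(0,\infty))$ with $\lim_{t\to\infty}\gamma_\pm(t)=\infty$ and $$\limsup_{t\to\infty}\frac{|H(t)|}{\gamma_+(t)}=0,\qquad\limsup_{t\to\infty}\frac{|H(t)|}{\gamma_-(t)}=\infty.$$ For $\gamma\in\{\gamma_+,\gamma_-\}$ put $$L_f(\gamma):=\lim_{t\to\infty}\frac{\gamma(t)}{\mu(\mathbb{R}^+)\int_0^t f(\gamma(s))\,ds}$$ whenever this limit exists in $[0,\infty]$. Let $x$ be a solution of $$x'(t)=\int_{[0,t]}\mu(ds)\,f(x(t-s))+h(t),\quad t>0,\qquad x(0)=\psi.$$ (a) If $L_f(\gamma_+)\in(1,\infty]$ and $L_f(\gamma_-)\in(1,\infty]$, then $$\limsup_{t\to\infty}\frac{|x(t)|}{\gamma_+(t)}\in\left[0,\frac{1}{L_f(\gamma_+)}\right],\qquad\limsup_{t\to\infty}\frac{|x(t)|}{\gamma_-(t)}=\infty,$$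 where $1/L_f(\gamma_+)$ is understood to be $0$ if $L_f(\gamma_+)=\infty$. (b) If $L_f(\gamma_+)=L_f(\gamma_-)=\infty$, then $$\lim_{t\to\infty}\frac{|x(t)|}{\gamma_+(t)}=0,\qquad\limsup_{t\to\infty}\frac{|x(t)|}{\gamma_-(t)}=\infty.$$
   Context: $\mathbb{R}^+=[0,\infty)$. A solution is a locally absolutely continuous function $x:[0,\infty)\to\mathbb{R}$ satisfying the equation for almost every $t\ge0$ together with the initial condition. *)

(* Defs.v *)
From HB Require Import structures.
From mathcomp Require Import all_boot all_order all_algebra.
From mathcomp Require Import all_classical all_reals all_analysis.
Set Implicit Arguments.
Unset Strict Implicit.
Unset Printing Implicit Defensive.
Import Order.TTheory GRing.Theory Num.Theory.
Import numFieldNormedType.Exports.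
Local Open Scope classical_set_scope.
Local Open Scope ring_scope.

(* The filter of the limits as |x| tends to infinity on the real line. *)
Definition norm_infty_nbhs (R : realType) : set_system R :=
  [set A | exists M : R, forall x : R, M < `|x| -> A x].
Arguments norm_infty_nbhs R : clear implicits.

Global Instance norm_infty_nbhs_filter (R : realType) :
  ProperFilter (norm_infty_nbhs R).
Proof.
split.
  move=> [M MA]; apply: (MA (`|M| + 1)).
  by rewrite (le_lt_trans (ler_norm M))// (lt_le_trans _ (ler_norm _))// ltrDl.
split; first by exists 0.
  move=> A B [M MA] [N NB]; exists (Num.max M N) => x.
  by rewrite gt_max => /andP[Mx Nx]; split; [exact: MA|exact: NB].
by move=> A B AB [M MA]; exists M => x /MA /AB.
Qed.

Definition limsup_pinfty (R : realType) (g : R -> R) : \bar R :=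
  limf_esup (fun t => (g t)%:E) +oo_R.

(* Functions on R^+ are total functions on R whose values on the negative
   half-line are irrelevant; the derivative at 0 is therefore one-sided. *)
Definition is_C1_Rplus (R : realType) (phi dphi : R -> R) : Prop :=
  (forall x : R, 0 <= x ->
     (fun y => (phi y - phi x) / (y - x)) @ within `[0, +oo[ x^' --> dphi x) /\
  {within `[0, +oo[, continuous dphi}.

Definition L1_loc_Rplus (R : realType) (h : R -> R) : Prop :=
  forall t : R, 0 <= t ->
    (@lebesgue_measure R).-integrable `[0, t] (fun s => (h s)%:E).

Definition abs_continuous (R : realType) (a b : R) (x : R -> R) : Prop :=
  forall e : R, 0 < e -> exists2 d : R, 0 < d &
    forall (n : nat) (u v : 'I_n -> R),
      (forall i, a <= u i /\ u i <= v i /\ v i <= b) ->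
      trivIset setT (fun i => `]u i, v i[%classic) ->
      \sum_(i < n) (v i - u i) < d ->
      \sum_(i < n) `|x (v i) - x (u i)| < e.

Definition loc_abs_continuous_Rplus (R : realType) (x : R -> R) : Prop :=
  forall t : R, 0 <= t -> abs_continuous 0 t x.

(* Increasing functions in C((0,oo);(0,oo)) tending to infinity; the weak form
   of monotonicity is the less restrictive hypothesis. *)
Definition growth_function (R : realType) (gamma : R -> R) : Prop :=
  [/\ {within `]0, +oo[, continuous gamma},
      forall t : R, 0 < t -> 0 < gamma t,
      forall s t : R, 0 < s -> s <= t -> gamma s <= gamma t
    & gamma t @[t --> +oo] --> +oo].

(* A Borel measure on R^+ is given by a Borel measure on R, of which only the
   restriction to [0, +oo[ is used. *)
Definition total_mass (R : realType)
    (mu : {measure set (measurableTypeR R) -> \bar R}) : R :=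
  fine (mu `[0, +oo[%classic).

(* L is the limit L_f(gamma); in particular the limit exists. *)
Definition is_Lf (R : realType)
    (mu : {measure set (measurableTypeR R) -> \bar R}) (f gamma : R -> R)
    (L : \bar R) : Prop :=
  (gamma t / (total_mass mu *
     \int[@lebesgue_measure R]_(s in `]0, t]) f (gamma s)))%:E
    @[t --> +oo] --> L.

Definition is_solution (R : realType)
    (mu : {measure set (measurableTypeR R) -> \bar R}) (f h : R -> R) (psi : R)
    (x : R -> R) : Prop :=
  [/\ loc_abs_continuous_Rplus x,
      x 0 = psi
    & {ae @lebesgue_measure R, forall t : R, 0 < t ->
        is_derive t 1 x
          (\int[mu]_(s in `[0, t]) f (x (t - s)) + h t)}].

(* Main.v *)
(* Put M = mu(R^+) and z = x - H.  Then z is locally absolutely continuous and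
   z'(t) is a.e. the convolution term, which is at most M * sup_[0,t] |f o x|.
   Since phi is concave and positive, phi (S y) <= S phi y for S >= 1; hence, if
   |x| <= S gamma on [T, t] with S >= 1, then
     |x t - H t| <= S (D + D t + a M int_0^t f(gamma)),   a > 1 arbitrary,
   and the right-hand side is at most S theta gamma(t) for large t as soon as
   theta > 1 / L_f(gamma).  For gamma_+ one may take theta < 1: a maximum
   argument bounds |x| / gamma_+, iterating S |-> S theta + e brings the bound
   below 1, and one more step brings it below 1 / L_f(gamma_+) + e.  For gamma_-,
   a bound |x| <= S gamma_- would bound |H| / gamma_-. *)
Require Import Defs.
From HB Require Import structures.
From mathcomp Require Import all_boot all_order all_algebra.
From mathcomp Require Import all_classical all_reals all_analysis.
Import Order.TTheory GRing.Theory Num.Theory.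
Import numFieldNormedType.Exports.
From mathcomp Require Import ring lra.
Local Open Scope classical_set_scope.
Local Open Scope ring_scope.

(** * Continuous induction and absolutely continuous functions *)

(** The supremum [s] of the points reached has a reached point [u] within the radius given at [s],
    and one step leads from [u] past [s] unless [s = b]. Steps straddle [t], so they may jump over
    the point [s]. *)
Lemma interval_chain {R : realType} {a b : R} {Q : R -> Prop} : a <= b -> Q a ->
  (forall t, a <= t <= b -> exists2 d, 0 < d & forall u v, a <= u -> u <= t ->
     t <= v -> v <= b -> t - u < d -> v - t < d -> Q u -> Q v) ->
  Q b.
Proof.
move=> ab Qa step; pose S := [set t | a <= t <= b /\ Q t].
have Sa : S a by split; rewrite ?lexx.
have ubS : ubound S b by move=> t [/andP[]].
have hS : has_sup S by split; [exists a|exists b].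
set s := sup S.
have as_ : a <= s by exact: (sup_upper_bound hS).
have sb : s <= b by apply: ge_sup => //; exists a.
have [|d d0 sd] := step s; first by rewrite as_.
have [u [/andP[au ub] Qu]] := sup_adherent d0 hS; rewrite -/s => su.
have us : u <= s by apply: (sup_upper_bound hS); split => //; rewrite au.
have [sltb|] := ltP s b; last first.
  by move=> bs; apply: (sd u b) => //; lra.
pose v := Num.min b (s + d / 2).
have sv : s < v by rewrite lt_min sltb/=; lra.
have vb : v <= b by rewrite ge_min lexx.
have vsd : v <= s + d / 2 by rewrite ge_min lexx orbT.
have : v <= s.
  apply: (sup_upper_bound hS); split; first by rewrite vb andbT; lra.
  by apply: (sd u v) => //; lra.
by lra.
Qed.

Lemma abs_continuousD {R : realType} {a b : R} {x y : R -> R} :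
  abs_continuous a b x -> abs_continuous a b y ->
  abs_continuous a b (fun t => x t + y t).
Proof.
move=> ax ay e e0; have e20 : 0 < e / 2 by lra.
have [d d0 hd] := ax _ e20; have [d' d'0 hd'] := ay _ e20.
exists (Num.min d d'); first by rewrite lt_min d0.
move=> n u v uv tI; rewrite lt_min => /andP[sd sd'].
have := hd _ _ _ uv tI sd; have := hd' _ _ _ uv tI sd'.
have : \sum_(i < n) `|x (v i) + y (v i) - (x (u i) + y (u i))| <=
   \sum_(i < n) `|x (v i) - x (u i)| + \sum_(i < n) `|y (v i) - y (u i)|.
  rewrite -big_split/=; apply: ler_sum => i _.
  by apply: le_trans (ler_normD _ _); rewrite opprD addrACA.
by lra.
Qed.

Lemma abs_continuousZ {R : realType} {a b : R} (c : R) {x : R -> R} :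
  abs_continuous a b x -> abs_continuous a b (fun t => c * x t).
Proof.
(* The [+ 1] keeps the divisor positive when [c = 0]. *)
move=> ax e e0; have c0 : 0 < `|c| + 1 by have := normr_ge0 c; lra.
have [d d0 hd] := ax _ (divr_gt0 e0 c0).
exists d => // n u v uv tI sd.
have := hd _ _ _ uv tI sd; rewrite ltr_pdivlMr// => sxe.
apply: le_lt_trans sxe; rewrite mulr_suml; apply: ler_sum => i _.
rewrite -mulrBr normrM mulrC ler_wpM2l//; lra.
Qed.

Lemma abs_continuous_id {R : realType} (a b : R) : abs_continuous a b id.
Proof.
move=> e e0; exists e => // n u v uv tI.
apply: le_lt_trans; apply: ler_sum => i _.
by rewrite ger0_norm// subr_ge0; have [_ []] := uv i.
Qed.

Lemma abs_continuous_sub {R : realType} {a b a' b' : R} {x : R -> R} :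
  a <= a' -> b' <= b -> abs_continuous a b x -> abs_continuous a' b' x.
Proof.
move=> aa' bb' ax e /ax[d d0 hd]; exists d => // n u v uv; apply: hd => i.
by have [? []] := uv i; do !split => //; lra.
Qed.

Lemma abs_continuous_dist {R : realType} {a b : R} {x : R -> R} :
  abs_continuous a b x -> forall e, 0 < e -> exists2 d, 0 < d &
    forall u v, a <= u -> u <= v -> v <= b -> v - u < d -> `|x v - x u| < e.
Proof.
move=> ax e /ax[d d0 hd]; exists d => // u v au uv vb vud.
have := hd 1%N (fun=> u) (fun=> v); rewrite !big_ord1; apply => //.
by apply/trivIsetP => i j _ _; rewrite !ord1.
Qed.

Lemma abs_continuous_within {R : realType} {a b : R} {x : R -> R} :
  abs_continuous a b x -> {within `[a, b], continuous x}.
Proof.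
move=> ax; apply/subspace_continuousP => t /= /[!in_itv]/= /andP[at_ tb].
apply/cvgrPdist_lt => e e0; have [d d0 hd] := abs_continuous_dist ax _ e0.
rewrite near_withinE; near=> s => /=; rewrite in_itv/= => /andP[as_ sb].
have : `|t - s| < d by near: s; exists d.
by have [ts|/ltW st] := leP t s; rewrite ltr_norml => /andP[h1 h2];
  [rewrite distrC|]; apply: hd => //; lra.
Unshelve. all: by end_near. Qed.

(** * Monotonicity from an almost everywhere nonpositive derivative *)

(** The increment splits at [t], and each half has a difference quotient based at [t] that is below
    [e]. Halves of zero length are treated apart, the quotient being controlled only off [h = 0]. *)
Lemma is_derive_le0_straddle {R : realType} {w : R -> R} {t d : R} :
  is_derive t 1 w d -> d <= 0 -> forall e, 0 < e -> exists2 r, 0 < r &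
    forall u v, u <= t -> t <= v -> t - u < r -> v - t < r ->
      w v - w u <= e * (v - u).
Proof.
move=> wd d0 e e0.
have /cvgrPdist_lt/(_ e e0) : h^-1 *: (w (h + t) - w t) @[h --> 0^'] --> d.
  have -> : (fun h => h^-1 *: (w (h + t) - w t)) =
      (fun h => h^-1 *: ((w \o shift t) (h *: 1) - w t)).
    by apply/funext => h; rewrite /= [_ *: 1]mulr1.
  by have [dw <-] := wd; exact: dw.
move=> [r /= r0 hr]; exists r => // u v ut tv tur vtr.
have Hv : w v - w t <= e * (v - t).
  move: tv; rewrite le_eqVlt => /predU1P[->|tv]; first by rewrite !subrr mulr0.
  have := hr (v - t); rewrite /ball_/= sub0r normrN gtr0_norm ?subr_gt0//.
  rewrite subrK gt_eqF ?subr_gt0// => /(_ vtr isT).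
  rewrite ltr_norml => /andP[+ _].
  set q := _ *: _ => hq.
  have -> : w v - w t = q * (v - t).
    by rewrite /q [_ *: _]mulrC mulfVK// gt_eqF ?subr_gt0.
  by rewrite ler_pM2r ?subr_gt0//; lra.
have Hu : w t - w u <= e * (t - u).
  move: ut; rewrite le_eqVlt => /predU1P[->|ut]; first by rewrite !subrr mulr0.
  have := hr (u - t); rewrite /ball_/= sub0r opprB gtr0_norm ?subr_gt0//.
  rewrite subrK lt_eqF ?subr_lt0// => /(_ tur isT).
  rewrite ltr_norml => /andP[+ _].
  set q := _ *: _ => hq.
  have -> : w t - w u = q * (t - u).
    by rewrite /q -[t - u]opprB -[LHS]opprB mulrN [_ *: _]mulrC mulfVK// lt_eqF ?subr_lt0.
  by rewrite ler_pM2r ?subr_gt0//; lra.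
lra.
Qed.

(** Outer regularity applies to a measurable null set [A] containing [N]: it makes the part of [U]
    outside [A] small, and [A] itself adds nothing. *)
Lemma open_cover_negligible {R : realType} {N : set R} {d : R} :
  (@lebesgue_measure R).-negligible N -> 0 < d ->
  exists U : set R, [/\ open U, N `<=` U & (lebesgue_measure U < d%:E)%E].
Proof.
move=> [A [mA A0 NA]] d0.
have muA : lebesgue_measure A = 0%E by exact: A0.
have muAoo : (lebesgue_measure A < +oo)%E by rewrite muA ltry.
have [U [oU AU UA]] := lebesgue_regularity_outer mA muAoo d0.
exists U; split => //; first exact: subset_trans AU.
have mU : measurable U by exact: measurable_realfun.open_measurable.
apply: le_lt_trans UA; rewrite -{1}(setDUK AU).
apply: (le_trans (measureU2 _ _ _)) => //; first exact: measurableD.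
by rewrite -[leRHS]add0e leeD// [leLHS]muA.
Qed.

(* The exceptional null set is covered by an open set [U] of small measure; [b] is
   reached from [a] by short steps, along which either the derivative bounds the
   increment of [w], or the step lies in [U] and absolute continuity bounds the
   total increment of such steps. *)
Lemma abs_continuous_le {R : realType} {a b : R} {w : R -> R} :
  a <= b -> abs_continuous a b w ->
  {ae @lebesgue_measure R, forall t, a < t < b ->
     exists2 d, is_derive t 1 w d & d <= 0} ->
  w b <= w a.
Proof.
move=> ab acw aew.
(* The two errors are a slope [e] along the interval and a total increment [e] inside [U]; running
   the argument with [e / (b - a + 1)] makes their sum [e]. *)
suff H e : 0 < e -> w b - w a <= e * (b - a) + e.
  apply/ler_addgt0Pr => e e0.
  have ba0 : 0 < b - a + 1 by lra.
  have E : e / (b - a + 1) * (b - a) + e / (b - a + 1) = e by field; lra.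
  by have := H _ (divr_gt0 e0 ba0); rewrite E; lra.
move=> e0; have [d d0 hd] := acw _ e0.
set mu := (@lebesgue_measure R) in aew.
(* The endpoints join [N], so that every point of [a, b] outside [U] is interior and the derivative
   hypothesis applies to it. *)
pose N := ~` [set t | a < t < b -> exists2 d, is_derive t 1 w d & d <= 0]
   `|` ([set a] `|` [set b]).
have Nn : mu.-negligible N.
  apply: negligibleU; first exact: aew.
  by apply: negligibleU; [exists [set a]|exists [set b]]; split => //;
    exact: lebesgue_measure_set1.
have [U [oU NU Ud]] := open_cover_negligible Nn d0.
have mU : measurable U by exact: measurable_realfun.open_measurable.
(* [Q t] records the steps made inside [U] up to [t]: they are disjoint, and their total length is
   controlled by the measure of [U] within ]a, t]. All other steps are charged to the slope [e]. *)
pose Q t := exists n (u v : 'I_n -> R),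
  [/\ forall i, a <= u i /\ u i <= v i /\ v i <= t,
      trivIset setT (fun i => `]u i, v i[%classic),
      ((\sum_(i < n) (v i - u i))%:E <= mu (U `&` `]a, t]))%E &
      w t - w a <= e * (t - a) + \sum_(i < n) `|w (v i) - w (u i)|].
have : Q b; last first.
  move=> [n [u [v [uv tI suv wba]]]].
  have : \sum_(i < n) `|w (v i) - w (u i)| < e; last by lra.
  apply: hd => //; rewrite -lte_fin; apply: le_lt_trans suv _.
  apply: le_lt_trans Ud; apply: le_measure; rewrite ?inE//.
  exact: measurableI.
apply: (interval_chain ab).
  exists 0%N, (fun=> 0), (fun=> 0); split => //; rewrite ?big_ord0 ?subrr ?mulr0 ?addr0//.
  - by case.
  - by apply/trivIsetP => -[].
move=> t /andP[at_ tb].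
have [Ut|nUt] := pselect (U t).
  have /nbhs_ballP[r /= r0 rU] : nbhs t U by exact: open_nbhs_nbhs.
  exists r => // p q ap pt tq qb tpr qtr [n [u [v [uv tI suv wpa]]]].
  (* The new interval ]p, q[ gets index [ord0] and the earlier ones are shifted; it lies to their
     right and inside the ball contained in [U]. *)
  exists n.+1, (fun i => oapp u p (unlift ord0 i)), (fun i => oapp v q (unlift ord0 i)).
  split.
  - move=> i; case: unliftP => [j _|_] /=; last by lra.
    by have [? []] := uv j; do !split => //; lra.
  - apply/trivIsetP => i j _ _.
    case: unliftP => [i' ->|->]; case: unliftP => [j' ->|->] ij //=.
    + by move/trivIsetP : tI; apply => //; apply: contra ij => /eqP ->.
    + rewrite -subset0 => z [] /=; rewrite !in_itv/= => /andP[_ zv] /andP[pz _].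
      by have [_ []] := uv i'; lra.
    + rewrite -subset0 => z [] /=; rewrite !in_itv/= => /andP[pz _] /andP[_ zv].
      by have [_ []] := uv j'; lra.
  - rewrite big_ord_recl/= unlift_none/= EFinD addeC.
    under eq_bigr do rewrite liftK/=.
    have -> : U `&` `]a, q]%classic = (U `&` `]a, p]%classic) `|` `]p, q]%classic.
      rewrite (@itv_bndbnd_setU _ _ _ (BRight p))//; rewrite ?bnd_simp; [|lra..].
      rewrite setIUr; congr (_ `|` _); apply/setIidr => z /=.
      rewrite in_itv/= => /andP[pz zq]; apply: rU; rewrite /ball/=.
      by rewrite ltr_distlC; lra.
    have mUp : measurable (U `&` `]a, p]%classic) by exact: measurableI.
    have Upq : (U `&` `]a, p]%classic) `&` `]p, q]%classic = set0.
      rewrite -subset0 => z [[_]] /=; rewrite !in_itv/= => /andP[_ h1] /andP[h2 _].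
      by lra.
    rewrite [leRHS]measureU//=.
    rewrite leeD//= lebesgue_measure_itv/= lte_fin -EFinB.
    by case: ifPn => // /negP; rewrite lee_fin; lra.
  - rewrite big_ord_recl/= unlift_none/=.
    under eq_bigr do rewrite liftK/=.
    have := ler_norm (w q - w p).
    have : e * (p - a) <= e * (q - a) by rewrite ler_pM2l//; lra.
    by lra.
have [N1 N2] : t <> a /\ t <> b.
  by split => tt; apply: nUt; apply: NU; right; [left|right].
have atb : a < t < b.
  apply/andP; split; rewrite lt_neqAle; apply/andP; split => //; apply/eqP => //.
  by move/esym.
have [dw [wd dw0]] : exists dw, is_derive t 1 w dw /\ dw <= 0.
  apply: contrapT => nd; apply: nUt; apply: NU; left.
  by move=> /(_ atb)[dw ? ?]; apply: nd; exists dw.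
have [r r0 hr] := is_derive_le0_straddle wd dw0 _ e0.
exists r => // p q ap pt tq qb tpr qtr [n [u [v [uv tI suv wpa]]]].
exists n, u, v; split => //.
- by move=> i; have [? []] := uv i; do !split => //; lra.
- apply: (le_trans suv); apply: le_measure; rewrite ?inE//.
  + exact: measurableI.
  + exact: measurableI.
  + by apply: setIS; apply: subset_itvl; rewrite bnd_simp; lra.
- by have := hr _ _ pt tq tpr qtr; lra.
Qed.

(** * Indefinite integrals *)

Lemma lebesgue_measure_oo {R : realType} (u v : R) : u <= v ->
  (@lebesgue_measure R) `]u, v[%classic = (v - u)%:E.
Proof.
move=> uv; rewrite lebesgue_measure_itv/= lte_fin -EFinB; case: ltP => // vu.
by congr EFin; lra.
Qed.

(** Increments over disjoint intervals sum to at most the integral of |g| over their union, which is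
    small with the measure of the union. The flag [c] covers both [a, t], used for [H], and ]a, t],
    used for [f \o gamma]. *)
Lemma abs_continuous_integral {R : realType} {c : bool} {a b : R} {g : R -> R} :
  (@lebesgue_measure R).-integrable [set` Interval (BSide c a) (BRight b)]
    (EFin \o g) ->
  abs_continuous a b (fun t =>
    \int[@lebesgue_measure R]_(s in [set` Interval (BSide c a) (BRight t)]) g s).
Proof.
move=> ig; set J := [set` _] in ig.
have mJ : measurable J by exact: measurable_itv.
(* [g] extended by zero off [J] is integrable over the whole line, where the absolute continuity of
   the integral is applied. *)
have ik : (@lebesgue_measure R).-integrable setT (EFin \o (g \_ J)).
  rewrite -restrict_EFin.
  by apply ((@integrable_mkcond _ _ R (@lebesgue_measure R) J (EFin \o g) mJ).1).
have ink := integrable_abse ik.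
move=> e e0; have [d [d0 hd]] := integral_normr_continuous ik e0.
exists d => // n u v uv tI suv.
have mI (i : 'I_n) : measurable `]u i, v i[%classic by exact: measurable_itv.
pose D := \big[setU/set0]_(i < n) `]u i, v i[%classic.
have mD : measurable D by exact: bigsetU_measurable.
have muD : ((@lebesgue_measure R) D < d%:E)%E.
  rewrite measure_bigsetU_ord// (eq_bigr (fun i => (v i - u i)%:E)).
    by rewrite sumEFin lte_fin.
  move=> i _; apply: lebesgue_measure_oo.
  by have [_ []] := uv i.
apply: le_lt_trans (hd _ mD muD).
have inkS A : measurable A ->
    (@lebesgue_measure R).-integrable A (EFin \o (fun s => `|(g \_ J) s|)).
  by move=> mA; apply: integrableS ink.
rewrite [leRHS](_ : _ =
    \sum_(i < n) \int[@lebesgue_measure R]_(s in `]u i, v i[) `|(g \_ J) s|).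
  apply: ler_sum => i _; have [aui [uvi vib]] := uv i.
  have sub : `]u i, v i] `<=` J.
    by move=> z; rewrite /J /= !in_itv/=; case: (c) => /=; lra.
  rewrite Rintegral_itvB; last 3 first.
  - apply: integrableS ig => //; apply: subset_itvl; rewrite bnd_simp; lra.
  - by rewrite bnd_simp; case: (c); rewrite ?bnd_simp//; lra.
  - by rewrite bnd_simp.
  apply: (le_trans (le_normr_Rintegral _ _)) => //; first exact: integrableS ig.
  rewrite Rintegral_itv_bndo_bndc; last exact: inkS.
  rewrite le_eqVlt; apply/orP; left; apply/eqP; apply: eq_Rintegral => z zuv.
  by rewrite patchE mem_set//; apply: sub; rewrite -inE.
rewrite /Rintegral ge0_integral_bigsetU//=.
- rewrite sum_fine// => i _; exact: integrable_fin_num (inkS _ _).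
- by rewrite /index_enum -enumT enum_uniq.
- exact: sub_trivIset tI.
- by have /integrableP[] := inkS _ mD.
Qed.

(** Almost every point is a Lebesgue point of the extension of [g] by zero, and there the
    fundamental theorem of calculus applies; for upper bounds near [t < b] the extension does not
    change the integral. *)
Lemma ae_derive_integral {R : realType} {c : bool} {a b : R} {g : R -> R} :
  (@lebesgue_measure R).-integrable [set` Interval (BSide c a) (BRight b)]
    (EFin \o g) ->
  {ae @lebesgue_measure R, forall t, a < t < b -> is_derive t 1 (fun t =>
    \int[@lebesgue_measure R]_(s in [set` Interval (BSide c a) (BRight t)]) g s)
    (g t)}.
Proof.
move=> ig; set J := [set` _] in ig.
have mJ : measurable J by exact: measurable_itv.
have := lebesgue_differentiation (integrable_locally mJ ig).
apply: filterS; first exact: (ae_filter_ringOfSetsType (@lebesgue_measure R)).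
move=> t lt /andP[at_ tb].
have ik : (@lebesgue_measure R).-integrable setT (EFin \o (g \_ J)).
  rewrite -restrict_EFin.
  by apply ((@integrable_mkcond _ _ R (@lebesgue_measure R) J (EFin \o g) mJ).1).
have at_' : (BSide c a < BRight t)%O by case: (c); rewrite bnd_simp ?ltW.
have tJ : t \in J.
  by rewrite mem_set// /J /= in_itv/= (ltW tb) andbT; case: (c); rewrite /= ?at_// ltW.
have ikJ : (@lebesgue_measure R).-integrable J (EFin \o (g \_ J)) by apply: integrableS ik.
have [//|dF dFE] := FTC1_lebesgue_pt tb ikJ _ lt.
have : is_derive t 1 (fun y => \int[@lebesgue_measure R]_(s in
    [set` Interval (BSide c a) (BRight y)]) (g \_ J) s) (g t).
  by apply: DeriveDef => //; rewrite -derive1E dFE patchE tJ.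
apply: near_eq_is_derive; near=> y; apply: eq_Rintegral => z.
rewrite inE/= in_itv/= patchE => /andP[az zy].
rewrite mem_set// /J /= in_itv/= az/= (le_trans zy)//.
near: y; exists (b - t); rewrite /= ?subr_gt0// => y /=.
by rewrite ltr_distlC => /andP[_ yb]; lra.
Unshelve. all: by end_near. Qed.

(** * Upper limits at infinity *)

Lemma limsup_pinfty_le {R : realType} {g : R -> R} {c : R} :
  (\forall t \near +oo, g t <= c) -> (limsup_pinfty g <= c%:E)%E.
Proof.
move=> gc; apply: (@le_trans _ _ (ereal_sup [set (g t)%:E | t in [set t | g t <= c]])).
  by apply: ereal_inf_lbound; exists [set t | g t <= c].
by apply: ge_ereal_sup => _ [t gt <-]; rewrite lee_fin.
Qed.

Lemma limsup_pinfty_lt {R : realType} {g : R -> R} {c : R} :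
  (limsup_pinfty g < c%:E)%E -> \forall t \near +oo, g t < c.
Proof.
move=> /ereal_inf_lt[_ [A Aoo <-] Ac]; apply: filterS Aoo => t At.
by rewrite -lte_fin; apply: le_lt_trans Ac; apply: ereal_sup_ubound; exists t.
Qed.

Lemma limsup_pinfty_ge0 {R : realType} {g : R -> R} :
  (\forall t \near +oo, 0 <= g t) -> (0 <= limsup_pinfty g)%E.
Proof.
move=> g0; apply: le_ereal_inf_tmp => _ [A Aoo <-].
have [t [gt At]] : exists t, 0 <= g t /\ A t.
  by apply: (@filter_ex _ (+oo : set_system R)); near=> t; split; near: t.
by apply: le_ereal_sup_tmp; exists (g t)%:E => //; exists t.
Unshelve. all: by end_near. Qed.

(** * The comparison function [phi] and the nonlinearity [f] *)

(** At a positive point the restriction to [0, +oo[ is invisible: increments of size below [x] stay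
    in the half-line. *)
Lemma is_C1_Rplus_is_derive {R : realType} {phi dphi : R -> R} {x : R} :
  is_C1_Rplus phi dphi -> 0 < x -> is_derive x 1 phi (dphi x).
Proof.
move=> [dphiE _] x0.
suff H : h^-1 *: (phi (h *: 1 + x) - phi x) @[h --> 0^'] --> dphi x.
  by apply: DeriveDef; [apply/cvg_ex; exists (dphi x)|apply/cvg_lim].
apply/cvgrPdist_lt => e e0.
have /cvgrPdist_lt/(_ e e0)[r /= r0 hr] := dphiE _ (ltW x0).
exists (Num.min r x); first by rewrite /= lt_min r0.
move=> h /=; rewrite sub0r normrN lt_min => /andP[hr' hx] h0.
rewrite [h *: 1]mulr1 [_ *: _]mulrC -{2}(addrK x h).
apply: hr => /=.
- by rewrite opprD addrCA subrr addr0 normrN.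
- by rewrite -subr_eq0 addrK.
- by rewrite in_itv/= andbT; move: hx; rewrite ltr_norml => /andP[]; lra.
Qed.

(* For [x < y], the increment of the concave function [phi] over [x, y] is at
   most [phi' x * (y - x)], and [x * phi' x <= phi x] since [phi] is positive. *)
Lemma concave_scale_le {R : realType} {phi dphi : R -> R} {x S : R} :
  is_C1_Rplus phi dphi -> (forall x, 0 <= x -> 0 < phi x) ->
  (forall x, 0 <= x -> 0 < dphi x) ->
  (forall x y, 0 <= x -> x <= y -> dphi y <= dphi x) ->
  0 < x -> 1 <= S -> phi (S * x) <= S * phi x.
Proof.
move=> C1 phi0 dphi0 dphi_dec x0 S1.
have D (z : R) : 0 < z -> is_derive z 1 phi (dphi z) by exact: is_C1_Rplus_is_derive.
have mvt (u v : R) : 0 < u -> u <= v ->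
    exists2 c, c \in `[u, v]%R & phi v - phi u = dphi c * (v - u).
  move=> u0 uv; apply: MVT_segment => //.
    by move=> z; rewrite in_itv/= => /andP[uz _]; apply: D; lra.
  apply: derivable_within_continuous => z; rewrite in_itv/= => /andP[uz _].
  by apply: ex_derive; apply: D; lra.
have xS : x <= S * x by rewrite ler_peMl// ltW.
have [c] := mvt _ _ x0 xS; rewrite in_itv/= => /andP[xc _] E1.
have h1 : dphi c * (S * x - x) <= dphi x * (S * x - x).
  by rewrite ler_wpM2r ?subr_ge0// dphi_dec// ltW.
have h2 : x * dphi x <= phi x.
  apply/ler_addgt0Pr => e e0.
  have dx := dphi0 _ (ltW x0).
  (* The mean value theorem is used on [z, x] with [z > 0], where [phi] has a two-sided derivative;
     this choice of [z] costs at most [e]. *)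
  pose z := Num.min x (e / dphi x).
  have z0 : 0 < z by rewrite lt_min x0 divr_gt0.
  have zx : z <= x by rewrite ge_min lexx.
  have ze : z * dphi x <= e by rewrite -ler_pdivlMr// ge_min lexx orbT.
  have [c'] := mvt _ _ z0 zx; rewrite in_itv/= => /andP[zc cx] E2.
  have : dphi x * (x - z) <= dphi c' * (x - z).
    by rewrite ler_wpM2r ?subr_ge0// dphi_dec//; lra.
  by have := phi0 _ (ltW z0); lra.
have h3 : (S - 1) * (x * dphi x) <= (S - 1) * phi x by rewrite ler_wpM2l//; lra.
lra.
Qed.

Lemma C1_Rplus_nondecreasing {R : realType} {phi dphi : R -> R} {x y : R} :
  is_C1_Rplus phi dphi -> (forall x, 0 <= x -> 0 < dphi x) ->
  0 < x -> x <= y -> phi x <= phi y.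
Proof.
move=> C1 dphi0 x0 xy.
have D (z : R) : 0 < z -> is_derive z 1 phi (dphi z) by exact: is_C1_Rplus_is_derive.
have [||c] := @MVT_segment _ phi dphi x y xy.
- by move=> z; rewrite in_itv/= => /andP[uz _]; apply: D; lra.
- apply: derivable_within_continuous => z; rewrite in_itv/= => /andP[uz _].
  by apply: ex_derive; apply: D; lra.
- rewrite in_itv/= => /andP[xc _] E.
  rewrite -subr_ge0 E mulr_ge0 ?subr_ge0// ltW// dphi0//; lra.
Qed.

Lemma continuous_bounded_itv {R : realType} {g : R -> R} {a b : R} :
  {within `[a, b], continuous g} ->
  exists2 C, 0 <= C & forall y, a <= y <= b -> `|g y| <= C.
Proof.
move=> cg; have [ab|ba] := leP a b; last by exists 0 => // y /andP[ay yb]; lra.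
have cng : {within `[a, b], continuous (fun y => `|g y|)}.
  apply: (@within_continuous_comp _ _ _ _ g (fun z : R => `|z|)) cg => z _.
  exact: norm_continuous.
have [c _ hc] := EVT_max ab cng.
by exists `|g c| => // y yab; apply: hc; rewrite in_itv.
Qed.

(** With [b] the square root of [a], large |y| give the chain |f y| <= b phi(|y|) <= b phi(S g) <= b
    S phi(g) <= b^2 S f(g); each of the two asymptotic relations costs one factor [b]. The constant
    [C] bounds |f| on the remaining compact range of [y], uniformly in [S] and [g]. *)
Lemma sublinear_comparison {R : realType} {f phi dphi : R -> R} :
  continuous f -> is_C1_Rplus phi dphi -> (forall x, 0 <= x -> 0 < phi x) ->
  (forall x, 0 <= x -> 0 < dphi x) ->
  (forall x y, 0 <= x -> x <= y -> dphi y <= dphi x) ->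
  f x / phi x @[x --> +oo] --> (1 : R) ->
  `|f x| / phi `|x| @[x --> norm_infty_nbhs R] --> (1 : R) ->
  forall a, 1 < a -> exists C, \forall g \near +oo, 0 < f g /\
    forall S y, 1 <= S -> `|y| <= S * g -> `|f y| <= C + a * S * f g.
Proof.
move=> cf C1 phi0 dphi0 dphi_dec fphi afphi a a1.
pose b := Num.sqrt a.
have bb : b * b = a by rewrite -expr2 sqr_sqrtr//; lra.
have b0 : 0 <= b := sqrtr_ge0 a.
have b1 : 1 < b by nra.
have [M hM] : \forall y \near norm_infty_nbhs R, `|f y| / phi `|y| < b.
  by apply: cvgr_lt afphi _ b1.
(* At least 1, so that |y| > M' makes |y| positive, as the monotonicity of [phi] requires. *)
pose M' := Num.max M 1.
have [M'M M'1] : M <= M' /\ 1 <= M' by rewrite !le_max !lexx orbT.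
have [C C0 hC] := @continuous_bounded_itv _ f (- M') M' (continuous_subspaceT cf).
exists C; near=> g.
have g0 : 0 < g by near: g; exact: nbhs_pinfty_gt.
have pg := phi0 _ (ltW g0).
have fg : phi g <= b * f g.
  have : b^-1 < f g / phi g.
    by near: g; apply: cvgr_gt fphi _ _; rewrite invf_lt1//; lra.
  rewrite ltr_pdivlMr// -ltr_pdivlMl ?invr_gt0; last by lra.
  by rewrite invrK => /ltW.
have fg0 : 0 < f g by nra.
split => // S y S1 yS.
have [yM|yM] := leP `|y| M'.
  have := hC y; rewrite -ler_norml => /(_ yM).
  have : 0 <= a * S * f g by rewrite !mulr_ge0//; lra.
  by lra.
have y0 : 0 < `|y| by lra.
have := hM y; rewrite ltr_pdivrMr ?phi0// => /(_ _)/ltW fy.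
have h1 : phi `|y| <= phi (S * g) by exact: C1_Rplus_nondecreasing C1 dphi0 _ _.
have h2 : phi (S * g) <= S * phi g.
  exact: concave_scale_le C1 phi0 dphi0 dphi_dec _ _.
have h3 : S * phi g <= S * (b * f g) by rewrite ler_wpM2l//; lra.
have h4 : b * phi `|y| <= b * (S * (b * f g)) by rewrite ler_wpM2l//; lra.
have -> : a * S * f g = b * (S * (b * f g)) by rewrite -bb; ring.
have := fy; lra.
Unshelve. all: by end_near. Qed.

(** * Integrability and the convolution term *)

Lemma bounded_continuous_integrable {R : realType}
    {mu : {measure set (measurableTypeR R) -> \bar R}} {A : set R} {g : R -> R}
    {C : R} :
  measurable A -> (mu A < +oo)%E -> {within A, continuous g} ->
  (forall y, A y -> `|g y| <= C) -> mu.-integrable A (EFin \o g).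
Proof.
move=> mA muA cg gC; apply: measurable_bounded_integrable => //.
  exact: measurable_realfun.subspace_continuous_measurable_fun.
exists C; split; first exact: num_real.
by move=> K CK y Ay; apply: le_trans (gC _ Ay) (ltW CK).
Qed.

Lemma within_continuous_reflect {R : realType} {g : R -> R} {t : R} :
  {within `[0, t], continuous g} ->
  {within `[0, t], continuous (fun s => g (t - s))}.
Proof.
move=> /subspace_continuousP cg; apply/subspace_continuousP => s /= st.
have ts : `[0, t]%classic (t - s).
  by move: st; rewrite /= !in_itv/= => /andP[? ?]; lra.
apply/cvgrPdist_lt => e e0.
have /cvgrPdist_lt/(_ e e0)[r /= r0 hr] := cg _ ts.
exists r => // z /= zr; rewrite in_itv/= => /andP[z0 zt]; apply: hr => /=.
  by rewrite (_ : t - s - (t - z) = - (s - z)) ?normrN//; ring.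
by rewrite in_itv/=; lra.
Qed.

Lemma convolution_bound {R : realType}
    {mu : {measure set (measurableTypeR R) -> \bar R}} {g : R -> R} {t B : R} :
  (mu `[0%R, +oo[%classic < +oo)%E -> {within `[0, t], continuous g} ->
  0 <= B -> (forall r, 0 <= r <= t -> `|g r| <= B) ->
  `|\int[mu]_(s in `[0, t]) g (t - s)| <= total_mass mu * B.
Proof.
move=> mu_fin cg B0 gB.
have sub : `[0, t]%classic `<=` `[0%R, +oo[%classic.
  by move=> z /=; rewrite !in_itv/= => /andP[->].
have mle : (mu `[0%R, t]%classic <= mu `[0%R, +oo[%classic)%E.
  by apply: le_measure; rewrite ?inE//; exact: measurable_itv.
have mfin : (mu `[0%R, t]%classic < +oo)%E by exact: le_lt_trans mu_fin.
have gtB s : `[0, t]%classic s -> `|g (t - s)| <= B.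
  by rewrite /= in_itv/= => /andP[s0 st]; apply: gB; lra.
have mI : measurable (`[0, t]%classic : set R) by exact: measurable_itv.
have ig : mu.-integrable `[0, t]%classic (EFin \o (fun s => g (t - s))).
  exact: (bounded_continuous_integrable mI mfin (within_continuous_reflect cg) gtB).
apply: (le_trans (le_normr_Rintegral _ ig)) => //.
apply: (@le_trans _ _ (\int[mu]_(s in `[0, t]) B)).
  apply: le_Rintegral => //; first exact: integrable_abse ig.
  apply: (bounded_continuous_integrable (C := B)) => //.
    by apply: continuous_subspaceT => z; exact: cst_continuous.
  by move=> y _; rewrite ger0_norm.
(* The mass of [0, t] is enlarged to the total mass, which uses [0 <= B]. *)
rewrite Rintegral_cst// mulrC ler_wpM2r// /total_mass fine_le//.
- by rewrite ge0_fin_numE.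
- by rewrite ge0_fin_numE.
Qed.

(** * Consequences of the limit L_f(gamma) *)

(** By monotonicity [gamma] maps ]0, b] into the compact interval [0, gamma b], where [f] is
    bounded; the value of [gamma] at 0 does not enter. *)
Lemma growth_integrable {R : realType} {f gamma : R -> R} (b : R) :
  continuous f -> growth_function gamma ->
  (@lebesgue_measure R).-integrable `]0, b] (EFin \o (f \o gamma)).
Proof.
move=> cf [cg g0 gmono _].
have [C C0 hC] := @continuous_bounded_itv _ f 0 (gamma b) (continuous_subspaceT cf).
have lb : (lebesgue_measure `]0%R, b]%classic < +oo)%E.
  by rewrite lebesgue_measure_itv/=; case: ifP; rewrite ?ltry.
apply: (bounded_continuous_integrable (C := C)).
- exact: measurable_itv.
- exact: lb.
- apply: within_continuous_comp => [z _|]; first exact: cf.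
  by apply: continuous_subspaceW cg; exact: subset_itvl.
- move=> y; rewrite /= in_itv/= => /andP[y0 yb]; apply: hC.
  by rewrite gmono// andbT ltW// g0.
Qed.

Lemma is_Lf_integral_le {R : realType}
    {mu : {measure set (measurableTypeR R) -> \bar R}} {f gamma : R -> R}
    {L : \bar R} {theta : R} :
  growth_function gamma -> is_Lf mu f gamma L -> 0 < theta ->
  (theta^-1%:E < L)%E ->
  \forall t \near +oo, total_mass mu *
    \int[@lebesgue_measure R]_(s in `]0, t]) f (gamma s) <= theta * gamma t.
Proof.
move=> [_ g0 _ _] LfL th0 thL.
have : \forall t \near +oo, (theta^-1%:E < (gamma t / (total_mass mu *
     \int[@lebesgue_measure R]_(s in `]0, t]) f (gamma s)))%:E)%E.
  move: L thL LfL => [l| |//]; last by move=> _ LfL; exact: (cvgey_gt LfL).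
  rewrite lte_fin => thl LfL.
  exact: (LfL _ (nbhs_open_ereal_gt (f := fun=> theta^-1) thl)).
move=> LfE; near=> t.
have t0 : 0 < t by near: t; exact: nbhs_pinfty_gt.
have : (theta^-1%:E < (gamma t / (total_mass mu *
     \int[@lebesgue_measure R]_(s in `]0, t]) f (gamma s)))%:E)%E by near: t.
rewrite lte_fin; set J := total_mass mu * _ => thJ.
have gt0 := g0 _ t0.
have thV : 0 < theta^-1 by rewrite invr_gt0.
(* A quotient above a positive number excludes a negative denominator as well as a zero one, for
   which the quotient would be 0 by convention. *)
have J0 : 0 < J by rewrite -invr_gt0 -(pmulr_rgt0 _ gt0) (lt_trans thV).
by move: thJ; rewrite ltr_pdivlMr// ltr_pdivrMl// => /ltW.
Unshelve. all: by end_near. Qed.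

(** Since f(gamma) tends to infinity, its integral outgrows every linear function, while L > 1
    eventually bounds that integral times the mass by [gamma]. This serves to absorb the terms
    [D + D * t] of the growth bound. *)
Lemma is_Lf_superlinear {R : realType}
    {mu : {measure set (measurableTypeR R) -> \bar R}} {f gamma : R -> R}
    {L : \bar R} {e : R} :
  0 < total_mass mu -> continuous f -> growth_function gamma ->
  f y @[y --> +oo] --> +oo ->
  is_Lf mu f gamma L -> (1 < L)%E -> 0 < e ->
  \forall t \near +oo, t <= e * gamma t.
Proof.
move=> M0 cf gg foo LfL L1 e0.
have [cg g0 gmono goo] := gg.
set M := total_mass mu in M0.
(* Gives M K (t - T) = (2 / e) (t - T), twice the slope required; the surplus outweighs the fixed
   offsets at [T]. *)
pose K := 2 / (M * e).
have [T [T0 hT]] : exists T : R, 0 < T /\ forall u : R, T <= u -> K <= f (gamma u).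
  have : \forall u \near +oo, K <= f (gamma u).
    have fg : f (gamma u) @[u --> +oo] --> +oo by exact: cvg_comp goo foo.
    by move/cvgryPge : fg; apply.
  move=> [T [_ hT]]; exists (Num.max 1 (T + 1)); split.
    by rewrite lt_max ltr01.
  by move=> u; rewrite ge_max => /andP[_ Tu]; apply: hT; lra.
pose I t := \int[@lebesgue_measure R]_(s in `]0, t]) f (gamma s).
have IK (t : R) : T <= t -> K * (t - T) <= I t - I T.
  move=> Tt; have ifg := growth_integrable (t + 1) cf gg.
  have acI : abs_continuous 0 (t + 1) I by exact: (abs_continuous_integral ifg).
  (* The comparison goes through K t - I t, whose derivative K - f(gamma t) is almost everywhere
     nonpositive beyond [T]. *)
  have : K * t + -1 * I t <= K * T + -1 * I T; last by lra.
  apply: (abs_continuous_le (w := fun t => K * t + -1 * I t) Tt).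
    apply: abs_continuousD; apply: abs_continuousZ.
      exact: abs_continuous_id.
    by apply: abs_continuous_sub acI; lra.
  have := ae_derive_integral ifg; apply: filterS.
    exact: (ae_filter_ringOfSetsType (@lebesgue_measure R)).
  move=> u hu /andP[Tu ut].
  have dI : is_derive u 1 I (f (gamma u)) by apply: hu; lra.
  exists (K - f (gamma u)); last by rewrite subr_le0 hT// ltW.
  apply: (is_derive_eq (f' := K *: 1 + -1 *: f (gamma u))).
  by rewrite /GRing.scale/=; ring.
have MI : \forall t \near +oo, M * I t <= 1 * gamma t.
  by apply: (is_Lf_integral_le gg LfL) => //; rewrite invr1.
near=> t.
have Tt : T <= t by near: t; apply: nbhs_pinfty_ge; exact: num_real.
have : M * I t <= 1 * gamma t by near: t.
have : M * (K * (t - T)) <= M * (I t - I T) by rewrite ler_pM2l// IK.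
have -> : M * (K * (t - T)) = 2 / e * (t - T) by rewrite /K; field; rewrite !gt_eqF.
have : e * (M * I T) - 2 * T + t >= 0.
  by rewrite -lerBlDl sub0r; near: t; apply: nbhs_pinfty_ge; exact: num_real.
move=> h1 h2 h3.
have h4 : e * (2 / e * (t - T)) <= e * (gamma t - M * I T) by rewrite ler_pM2l//; lra.
have : e * (2 / e * (t - T)) = 2 * (t - T) :> R by field; rewrite gt_eqF.
lra.
Unshelve. all: by end_near. Qed.

(** * Growth of solutions *)

Lemma solution_continuous {R : realType}
    {mu : {measure set (measurableTypeR R) -> \bar R}} {f h : R -> R} {psi : R}
    {x : R -> R} (t : R) :
  is_solution mu f h psi x -> 0 <= t -> {within `[0, t], continuous x}.
Proof. by move=> [acx _ _] t0; exact: abs_continuous_within (acx _ t0). Qed.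

Lemma forcing_abs_continuous {R : realType} {h H : R -> R} (b : R) :
  L1_loc_Rplus h ->
  (forall t : R, 0 <= t -> H t = \int[@lebesgue_measure R]_(s in `[0, t]) h s) ->
  0 <= b -> abs_continuous 0 b H.
Proof.
move=> h_loc HE b0 e e0.
have [d d0 hd] := abs_continuous_integral (c := true) (h_loc _ b0) _ e0.
exists d => // n u v uv tI suv; apply: le_lt_trans (hd n u v uv tI suv).
by apply: ler_sum => i _; have [? [? ?]] := uv i; rewrite !HE//; lra.
Qed.

Lemma ae_derive_forcing {R : realType} {h H : R -> R} (b : R) :
  L1_loc_Rplus h ->
  (forall t : R, 0 <= t -> H t = \int[@lebesgue_measure R]_(s in `[0, t]) h s) ->
  0 <= b ->
  {ae @lebesgue_measure R, forall t : R, 0 < t < b -> is_derive t 1 H (h t)}.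
Proof.
move=> h_loc HE b0; have := ae_derive_integral (c := true) (h_loc _ b0).
apply: filterS; first exact: (ae_filter_ringOfSetsType (@lebesgue_measure R)).
move=> t dt t0b; have := dt t0b; apply: near_eq_is_derive; near=> s.
rewrite HE//; near: s; exists t => /=; first by case/andP: t0b.
by move=> s /=; rewrite ltr_distlC => /andP[]; lra.
Unshelve. all: by end_near. Qed.

(* Both [x - H] and [H - x] have a.e. derivative at most
   [M * (C' + a * S * f (gamma u))] on [[T, t]], where [M] is the mass of [mu]. *)
Lemma solution_growth_bound {R : realType}
    {mu : {measure set (measurableTypeR R) -> \bar R}} {f h H : R -> R} {psi : R}
    {x gamma : R -> R} {a C : R} :
  (mu `[0%R, +oo[%classic < +oo)%E -> continuous f -> L1_loc_Rplus h ->
  (forall t : R, 0 <= t -> H t = \int[@lebesgue_measure R]_(s in `[0, t]) h s) ->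
  is_solution mu f h psi x -> growth_function gamma -> 0 <= a ->
  (\forall g \near +oo, 0 < f g /\
    forall S y, 1 <= S -> `|y| <= S * g -> `|f y| <= C + a * S * f g) ->
  \forall T \near +oo, exists D, forall t S : R, T <= t -> 1 <= S ->
    (forall r : R, T <= r <= t -> `|x r| <= S * gamma r) ->
    `|x t - H t| <= S * (D + D * t + a * (total_mass mu *
       \int[@lebesgue_measure R]_(s in `]0, t]) f (gamma s))).
Proof.
move=> mu_fin cf h_loc HE xsol gg a0 fC.
have [cg g0 gmono goo] := gg.
set M := total_mass mu.
have M0 : 0 <= M by rewrite fine_ge0.
pose I t := \int[@lebesgue_measure R]_(s in `]0, t]) f (gamma s).
have [T0 [_ hT0]] : \forall u \near +oo, 0 < f (gamma u) /\
    forall S y, 1 <= S -> `|y| <= S * gamma u -> `|f y| <= C + a * S * f (gamma u).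
  exact: (goo _ fC).
near=> T.
have T0T : T0 < T by near: T; apply: nbhs_pinfty_gt; exact: num_real.
have T_gt0 : 0 < T by near: T; apply: nbhs_pinfty_gt; exact: num_real.
have cfx (b : R) : 0 <= b -> {within `[0, b], continuous (f \o x)}.
  move=> b0; apply: within_continuous_comp => [z _|]; first exact: cf.
  exact: solution_continuous xsol b0.
have [CT CT0 hCT] := continuous_bounded_itv (cfx _ (ltW T_gt0)).
(* The convolution reaches back to time 0: [CT] bounds |f(x)| on [0, T], and [C] is the constant of
   the comparison used beyond [T]. *)
pose C' := Num.max CT C.
have [CTC CC] : CT <= C' /\ C <= C' by rewrite !le_max !lexx orbT.
pose D := `|x T - H T| + M * C' + M * (a * `|I T|).
exists D => t S Tt S1 xS.
have t0 : 0 < t by lra.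
have kB u : T < u -> u < t ->
    `|\int[mu]_(s in `[0, u]) f (x (u - s))| <= M * (C' + a * S * f (gamma u)).
  move=> Tu ut; have u0 : 0 <= u by lra.
  have [fu0 fuC] := hT0 u (lt_trans T0T Tu).
  have asf : 0 <= a * S * f (gamma u) by rewrite !mulr_ge0//; lra.
  apply: (convolution_bound (g := f \o x) mu_fin (cfx u u0)); first lra.
  move=> r /andP[r0 ru] /=; have [rT|Tr] := leP r T.
    by have := hCT r; rewrite r0 rT => /(_ isT) /=; lra.
  have : `|f (x r)| <= C + a * S * f (gamma u); last by lra.
  (* As [gamma] is nondecreasing, |x r| <= S gamma(u), so the comparison at the single argument
     gamma(u) serves every [r] in ]T, u]. *)
  apply: fuC => //; apply: (@le_trans _ _ (S * gamma r)).
    by apply: xS; lra.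
  by rewrite ler_pM2l; [apply: gmono; lra|lra].
have ifg := growth_integrable (t + 1) cf gg.
have acI : abs_continuous T t I.
  by apply: abs_continuous_sub (abs_continuous_integral ifg); lra.
have acx : abs_continuous T t x.
  have [acx _ _] := xsol; apply: abs_continuous_sub (acx t (ltW t0)); lra.
have acH : abs_continuous T t H.
  apply: abs_continuous_sub (forcing_abs_continuous t h_loc HE (ltW t0)); lra.
(* This is s (x - H) minus a primitive of the derivative bound; the forcing [h] cancels in its
   derivative, and s = 1, s = -1 give the two signs. *)
pose w s u := (s * x u + - s * H u) + (- (M * C') * u + - (M * (a * S)) * I u).
have wle s : s = 1 \/ s = -1 -> w s t <= w s T.
  move=> s1; apply: abs_continuous_le => //.
    by apply: abs_continuousD; apply: abs_continuousD; apply: abs_continuousZ => //;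
      exact: abs_continuous_id.
  have [_ _ xae] := xsol.
  have Hae := ae_derive_forcing t h_loc HE (ltW t0).
  have Iae := ae_derive_integral ifg.
  move: xae Hae Iae; apply: filterS3.
    exact: (ae_filter_ringOfSetsType (@lebesgue_measure R)).
  move=> u xu Hu Iu /andP[Tu ut].
  have dx := xu (lt_trans T_gt0 Tu).
  have dH : is_derive u 1 H (h u) by apply: Hu; lra.
  have dI : is_derive u 1 I (f (gamma u)) by apply: Iu; lra.
  move: dx; set k := Rintegral _ _ _ => dx.
  exists (s * k - M * (C' + a * S * f (gamma u))).
    apply: (is_derive_eq (f' := (s *: (k + h u) + - s *: h u) +
      (- (M * C') *: 1 + - (M * (a * S)) *: f (gamma u)))).
    by rewrite /GRing.scale/=; ring.
  have := kB u Tu ut; rewrite -/k ler_norml => /andP[k1 k2].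
  by case: s1 => ->; lra.
have := wle 1 (or_introl erefl); have := wle (-1) (or_intror erefl).
rewrite /w => w1 w2.
have e1 : `|x t - H t| <= `|x T - H T| + M * C' * (t - T) + M * (a * S) * (I t - I T).
  have := ler_norm (x T - H T); have := ler_norm (- (x T - H T)); rewrite normrN.
  by rewrite ler_norml => n1 n2; apply/andP; split; lra.
have n0 := normr_ge0 (x T - H T).
have MC0 : 0 <= M * C' by rewrite mulr_ge0//; lra.
have e2 : - (M * (a * S) * I T) <= S * (M * (a * `|I T|)).
  have -> : - (M * (a * S) * I T) = S * (M * (a * - I T)) by ring.
  rewrite ler_pM2l; last lra.
  by do 2 rewrite ler_wpM2l//; rewrite -normrN ler_norm.
have MaI : 0 <= M * (a * `|I T|) by rewrite !mulr_ge0.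
have D0 : 0 <= D by rewrite !addr_ge0.
(* Terms free of [S] are enlarged by the factor [S >= 1], which makes the final bound homogeneous in
   [S]. *)
have e3 : `|x T - H T| <= S * `|x T - H T| by rewrite ler_peMl.
have e4 : M * C' * (t - T) <= S * (M * C' * t).
  apply: (@le_trans _ _ (M * C' * t)); first by rewrite ler_wpM2l//; lra.
  by rewrite ler_peMl// mulr_ge0// ltW.
have e5 : S * (M * C' * t) <= S * (D * t).
  by rewrite ler_pM2l ?ler_pM2r//; rewrite /D; lra.
have e6 : S * D = S * `|x T - H T| + S * (M * C') + S * (M * (a * `|I T|)).
  by rewrite /D; ring.
have e7 : 0 <= S * (M * C') by rewrite mulr_ge0//; lra.
have -> : S * (D + D * t + a * (M * I t)) = S * D + S * (D * t) + M * (a * S) * I t by ring.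
lra.
Unshelve. all: by end_near. Qed.

(** The threshold for [t] depends on [T] but not on [S]: this allows [S] to be the maximum of |x| /
    gamma over an interval, and to change along an iteration. *)
Definition self_dominated {R : realType} (x H gamma : R -> R) (theta : R) :=
  \forall T \near +oo, \forall t \near +oo, forall S : R, 1 <= S ->
    (forall r : R, T <= r <= t -> `|x r| <= S * gamma r) ->
    `|x t - H t| <= S * (theta * gamma t).

(** Since 1 / theta < L, there is room for some [q] below [L] and some [a > 1] with a / q < theta;
    the remaining share (theta - a / q) gamma absorbs D + D t, because t = o(gamma). *)
Lemma solution_self_dominated {R : realType}
    {mu : {measure set (measurableTypeR R) -> \bar R}} {f h H : R -> R} {psi : R}
    {x gamma : R -> R} {L : \bar R} {theta : R} :
  0 < total_mass mu -> (mu `[0%R, +oo[%classic < +oo)%E ->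
  continuous f -> f y @[y --> +oo] --> +oo -> L1_loc_Rplus h ->
  (forall t : R, 0 <= t -> H t = \int[@lebesgue_measure R]_(s in `[0, t]) h s) ->
  is_solution mu f h psi x -> growth_function gamma ->
  (forall a : R, 1 < a -> exists C, \forall g \near +oo, 0 < f g /\
    forall S y, 1 <= S -> `|y| <= S * g -> `|f y| <= C + a * S * f g) ->
  is_Lf mu f gamma L -> (1 < L)%E -> 0 < theta -> (theta^-1%:E < L)%E ->
  self_dominated x H gamma theta.
Proof.
move=> M0 mu_fin cf foo h_loc HE xsol gg fC LfL L1 th0 thL.
have [_ g0 _ _] := gg.
have [q thq qL] : exists2 q : R, theta^-1 < q & (q%:E < L)%E.
  move: L thL {LfL L1} => [l| |//].
    rewrite lte_fin => thl; exists ((theta^-1 + l) / 2); first by lra.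
    by rewrite lte_fin; lra.
  by move=> _; exists (theta^-1 + 1); rewrite ?ltry//; lra.
have thV : 0 < theta^-1 by rewrite invr_gt0.
have q0 : 0 < q by lra.
have qth : q^-1 < theta by rewrite -[theta]invrK ltf_pV2.
have qV : 0 < q^-1 by rewrite invr_gt0.
(* Midpoint of 1 and theta q, hence above 1 and with a / q < theta. *)
pose a := (1 + theta * q) / 2.
have thq1 : 1 < theta * q by rewrite mulrC -ltr_pdivrMr// mul1r.
have a1 : 1 < a by rewrite /a; lra.
have aq : a * q^-1 < theta by rewrite ltr_pdivrMr// /a; lra.
have [C hC] := fC _ a1.
have a0 : 0 <= a by lra.
have K := solution_growth_bound mu_fin cf h_loc HE xsol gg a0 hC.
apply: filterS K => T [D hD].
(* For t >= 1, D + D t <= 2 (|D| + 1) t, and 2 (|D| + 1) e is exactly the share left over. *)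
pose e := (theta - a * q^-1) / (2 * (`|D| + 1)).
have D1 : 0 < `|D| + 1 by rewrite ltr_pwDr.
have e0 : 0 < e by rewrite divr_gt0//; lra.
near=> t => S S1 xS.
have t1 : 1 <= t by near: t; apply: nbhs_pinfty_ge; exact: num_real.
have gt0 : 0 < gamma t by apply: g0; lra.
have te : t <= e * gamma t by near: t; exact: (is_Lf_superlinear M0 cf gg foo LfL L1 e0).
have MI : total_mass mu * \int[@lebesgue_measure R]_(s in `]0, t]) f (gamma s)
    <= q^-1 * gamma t.
  by near: t; apply: (is_Lf_integral_le gg LfL) => //; rewrite invrK.
have Tt : T <= t by near: t; apply: nbhs_pinfty_ge; exact: num_real.
apply: (le_trans (hD _ _ Tt S1 xS)); rewrite ler_pM2l; last lra.
move: MI; set MI := total_mass mu * _ => hMI.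
have h1 : a * MI <= a * (q^-1 * gamma t) by rewrite ler_wpM2l.
have h2 : D + D * t <= (2 * (`|D| + 1)) * t.
  have : D <= `|D| by exact: ler_norm.
  have d1 : D <= `|D| * t.
    by apply: le_trans (ler_norm _) _; rewrite ler_peMr.
  have d2 : D * t <= `|D| * t by rewrite ler_wpM2r ?ler_norm//; lra.
  by lra.
have h3 : (2 * (`|D| + 1)) * t <= (2 * (`|D| + 1)) * (e * gamma t).
  by rewrite ler_pM2l//; lra.
have h4 : (2 * (`|D| + 1)) * (e * gamma t) = (theta - a * q^-1) * gamma t.
  by rewrite /e; field; rewrite !gt_eqF.
lra.
Unshelve. all: by end_near. Qed.

(** * Bounds drawn from self-domination *)

Lemma eventually_ge {R : realType} {P : R -> Prop} :
  (\forall t \near +oo, P t) <-> exists T : R, forall t, T <= t -> P t.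
Proof.
split=> [[T [_ hT]]|[T hT]]; first by exists (T + 1) => t Tt; apply: hT; lra.
by near=> t; apply: hT; near: t; apply: nbhs_pinfty_ge; exact: num_real.
Unshelve. all: by end_near. Qed.

(** One iteration S -> S theta + e, by the triangle inequality for x = (x - H) + H, with [T] taken
    beyond the point from which the bound by [S] holds. *)
Lemma dominated_contract {R : realType} {x H gamma : R -> R} {theta S e : R} :
  (forall t : R, 0 < t -> 0 < gamma t) ->
  self_dominated x H gamma theta ->
  (\forall t \near +oo, `|H t| <= e * gamma t) -> 1 <= S ->
  (\forall t \near +oo, `|x t| <= S * gamma t) ->
  \forall t \near +oo, `|x t| <= (S * theta + e) * gamma t.
Proof.
move=> g0 K He S1 /eventually_ge[T0 hT0].
have [T [T0T hT]] : exists T, T0 <= T /\ \forall t \near +oo,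
    forall S : R, 1 <= S ->
    (forall r : R, T <= r <= t -> `|x r| <= S * gamma r) ->
    `|x t - H t| <= S * (theta * gamma t).
  apply: (@filter_ex _ (+oo : set_system R)); near=> T; split; last by near: T; exact: K.
  by near: T; apply: nbhs_pinfty_ge; exact: num_real.
near=> t.
have h1 : `|H t| <= e * gamma t by near: t.
have h2 : `|x t - H t| <= S * (theta * gamma t).
  have : forall S : R, 1 <= S ->
    (forall r : R, T <= r <= t -> `|x r| <= S * gamma r) ->
    `|x t - H t| <= S * (theta * gamma t) by near: t.
  by apply=> // r /andP[Tr _]; apply: hT0; lra.
have := ler_normD (x t - H t) (H t); rewrite subrK; lra.
Unshelve. all: by end_near. Qed.

(* The maximum of [|x| / gamma] on [[T, t]] is attained either on the fixed
   interval [[T, T2]] or at a point where self-domination bounds it by [1]. *)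
Lemma dominated_bounded {R : realType} {x H gamma : R -> R} {theta : R} :
  (forall t : R, 0 < t -> 0 < gamma t) ->
  {within `]0, +oo[, continuous gamma} ->
  (forall t : R, 0 <= t -> {within `[0, t], continuous x}) ->
  self_dominated x H gamma theta -> theta < 1 ->
  (\forall t \near +oo, `|H t| <= (1 - theta) * gamma t) ->
  exists2 S, 1 <= S & \forall t \near +oo, `|x t| <= S * gamma t.
Proof.
move=> g0 cg cx K th1 He.
have [T [T0 hT]] : exists T : R, 0 < T /\ \forall t \near +oo,
    forall S : R, 1 <= S ->
    (forall r : R, T <= r <= t -> `|x r| <= S * gamma r) ->
    `|x t - H t| <= S * (theta * gamma t).
  apply: (@filter_ex _ (+oo : set_system R)); near=> T; split; last by near: T; exact: K.
  by near: T; apply: nbhs_pinfty_gt; exact: num_real.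
have [T2 [TT2 hT2]] : exists T2 : R, T <= T2 /\ forall t : R, T2 <= t ->
    `|H t| <= (1 - theta) * gamma t /\
    forall S : R, 1 <= S ->
    (forall r : R, T <= r <= t -> `|x r| <= S * gamma r) ->
    `|x t - H t| <= S * (theta * gamma t).
  move: He hT => /eventually_ge[U hU] /eventually_ge[V hV].
  exists (Num.max T (Num.max U V)); split; first by rewrite le_max lexx.
  by move=> t; rewrite !ge_max => /and3P[_ Ut Vt]; split; [exact: hU|exact: hV].
pose y t := `|x t| / gamma t.
have cy t : T <= t -> {within `[T, t], continuous y}.
  move=> Tt; have sx : `[T, t] `<=` `[0, t] by apply: subset_itvr; rewrite bnd_simp ltW.
  have sg : `[T, t] `<=` `]0, +oo[.
    by move=> z /=; rewrite !in_itv/= => /andP[? _]; lra.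
  have /subspace_continuousP cx' := continuous_subspaceW sx (cx t (le_trans (ltW T0) Tt)).
  have /subspace_continuousP cg' := continuous_subspaceW sg cg.
  apply/subspace_continuousP => z zTt.
  apply: cvgM; first exact: cvg_norm (cx' _ zTt).
  apply: cvgV; last exact: cg'.
  by rewrite gt_eqF// g0//; move: zTt; rewrite /= in_itv/= => /andP[? _]; lra.
have ymul t : 0 < t -> `|x t| = y t * gamma t.
  by move=> t0; rewrite /y divfK// gt_eqF// g0.
have [c2 _ hc2] := EVT_max TT2 (cy _ TT2).
exists (Num.max 1 (y c2)); first by rewrite le_max lexx.
near=> t.
have Tt : T <= t by near: t; apply: nbhs_pinfty_ge; exact: num_real.
have [c] := EVT_max Tt (cy _ Tt); rewrite in_itv/= => /andP[Tc ct] hc.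
have t0 : 0 < t by lra.
have c0 : 0 < c by lra.
rewrite ymul// ler_pM2r ?g0//.
apply: le_trans (hc t _) _; first by rewrite in_itv/= Tt lexx.
rewrite le_max; have [cT2|T2c] := leP c T2.
  by rewrite hc2 ?orbT// in_itv/= Tc.
have [//|y1] := leP (y c) 1.
have [Hc xc] := hT2 c (ltW T2c).
have gc := g0 _ c0.
(* At a maximum point c > T2 with y c > 1, the value S = y c is admissible and yields y c <= y c
   theta + 1 - theta, impossible for theta < 1. *)
have := xc (y c) (ltW y1).
have ybnd r : T <= r <= c -> `|x r| <= y c * gamma r.
  move=> /andP[Tr rc]; have r0 : 0 < r by lra.
  by rewrite ymul// ler_pM2r ?g0// hc// in_itv/= Tr; lra.
move=> /(_ ybnd) h1.
have h2 := ler_normD (x c - H c) (H c); rewrite subrK ymul// in h2.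
have h3 : y c * gamma c <= (y c * theta + (1 - theta)) * gamma c by lra.
move: h3; rewrite ler_pM2r// => h3.
nra.
Unshelve. all: by end_near. Qed.

(** Starting from some bound [S >= 1], an error S (1 - theta) / 2 allowed for [H] turns each
    contraction into multiplication by q = (1 + theta) / 2 < 1, so finitely many contractions
    suffice. *)
Lemma dominated_le_gamma {R : realType} {x H gamma : R -> R} {theta : R} :
  (forall t : R, 0 < t -> 0 < gamma t) ->
  {within `]0, +oo[, continuous gamma} ->
  (forall t : R, 0 <= t -> {within `[0, t], continuous x}) ->
  self_dominated x H gamma theta -> 0 < theta -> theta < 1 ->
  (forall e : R, 0 < e -> \forall t \near +oo, `|H t| <= e * gamma t) ->
  \forall t \near +oo, `|x t| <= gamma t.
Proof.
move=> g0 cg cx K th0 th1 He.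
have th1' : 0 < 1 - theta by lra.
have [S S1 xS] := dominated_bounded g0 cg cx K th1 (He _ th1').
have le_mono u v : u <= v -> (\forall t \near +oo, `|x t| <= u * gamma t) ->
    \forall t \near +oo, `|x t| <= v * gamma t.
  move=> uv xu; near=> t; apply: (@le_trans _ _ (u * gamma t)); first by near: t.
  by rewrite ler_wpM2r// ltW// g0//; near: t; apply: nbhs_pinfty_gt; exact: num_real.
suff : \forall t \near +oo, `|x t| <= 1 * gamma t.
  by apply: filterS => t; rewrite mul1r.
pose q := (1 + theta) / 2.
have [q0 q1] : 0 < q /\ q < 1 by rewrite /q; split; lra.
have [n qn] : exists n, S * q ^+ n <= 1.
  have := @cvg_expr R q; rewrite gtr0_norm// => /(_ q1).
  have SV : 0 < S^-1 by rewrite invr_gt0; lra.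
  move=> /cvgr0Pnorm_lt /(_ _ SV)[n _ hn]; exists n.
  have := hn n (leqnn n); rewrite /= gtr0_norm ?exprn_gt0// => /ltW.
  by rewrite -ler_pdivlMl ?mulr1//; lra.
elim: n S S1 xS qn => [|n IH] S S1 xS.
  by rewrite expr0 mulr1 => SL1; apply: le_mono xS.
rewrite exprS mulrA => qn.
have xSq : \forall t \near +oo, `|x t| <= (S * q) * gamma t.
  have e0 : 0 < S * ((1 - theta) / 2) by rewrite mulr_gt0//; lra.
  have -> : S * q = S * theta + S * ((1 - theta) / 2) by rewrite /q; field.
  exact: dominated_contract g0 K (He _ e0) S1 xS.
(* Self-domination is available only for constants at least 1; once S q < 1 the iteration stops, the
   bound being already good enough. *)
have [Sq1|Sq1] := leP 1 (S * q); first exact: IH xSq qn.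
exact: le_mono (ltW Sq1) xSq.
Unshelve. all: by end_near. Qed.

Lemma cvg_ratio_pinfty {R : realType} {f phi : R -> R} :
  f y / phi y @[y --> +oo] --> (1 : R) -> phi y @[y --> +oo] --> +oo ->
  f y @[y --> +oo] --> +oo.
Proof.
move=> fphi phioo; apply/cvgryPge => A; near=> y.
have p : Num.max 1 (2 * A) <= phi y by near: y; move/cvgryPge : phioo; apply.
move: p; rewrite ge_max => /andP[p1 pA].
have : 2^-1 < f y / phi y by near: y; apply: cvgr_gt fphi _ _; lra.
by rewrite ltr_pdivlMr; lra.
Unshelve. all: by end_near. Qed.

(** * Upper limits of ratios to [gamma] *)

Lemma limsup_ratio_lt {R : realType} {u gamma : R -> R} {e : R} :
  (forall t : R, 0 < t -> 0 < gamma t) ->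
  (limsup_pinfty (fun t => `|u t| / gamma t)%R < e%:E)%E ->
  \forall t \near +oo, `|u t| <= e * gamma t.
Proof.
move=> g0 /limsup_pinfty_lt ue; near=> t.
have t0 : 0 < t by near: t; apply: nbhs_pinfty_gt; exact: num_real.
have : `|u t| / gamma t < e by near: t.
by rewrite ltr_pdivrMr ?g0// => /ltW.
Unshelve. all: by end_near. Qed.

Lemma limsup_ratio_le {R : realType} {u gamma : R -> R} {e : R} :
  (forall t : R, 0 < t -> 0 < gamma t) ->
  (\forall t \near +oo, `|u t| <= e * gamma t) ->
  (limsup_pinfty (fun t => `|u t| / gamma t)%R <= e%:E)%E.
Proof.
move=> g0 ue; apply: limsup_pinfty_le; near=> t.
rewrite ler_pdivrMr; first by near: t.
by apply: g0; near: t; apply: nbhs_pinfty_gt; exact: num_real.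
Unshelve. all: by end_near. Qed.

Lemma limsup_ratio_ge0 {R : realType} (u : R -> R) {gamma : R -> R} :
  (forall t : R, 0 < t -> 0 < gamma t) ->
  (0 <= limsup_pinfty (fun t => `|u t| / gamma t)%R)%E.
Proof.
move=> g0; apply: limsup_pinfty_ge0; near=> t.
have t0 : 0 < t by near: t; apply: nbhs_pinfty_gt; exact: num_real.
by rewrite divr_ge0// ltW// g0.
Unshelve. all: by end_near. Qed.

(** Some theta < 1 first yields a bound by [gamma]; a single contraction from [S = 1] with theta = r
    + e / 2 and error e / 2 then reaches r + e. The real [r] is 1 / L, or 0 when [L] is infinite. *)
Lemma limsup_ratio_le_inve {R : realType} {x H gamma : R -> R} {L : \bar R} :
  (forall t : R, 0 < t -> 0 < gamma t) ->
  {within `]0, +oo[, continuous gamma} ->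
  (forall t : R, 0 <= t -> {within `[0, t], continuous x}) ->
  (forall e : R, 0 < e -> \forall t \near +oo, `|H t| <= e * gamma t) ->
  (1 < L)%E ->
  (forall theta : R, 0 < theta -> (theta^-1%:E < L)%E ->
     self_dominated x H gamma theta) ->
  (limsup_pinfty (fun t => `|x t| / gamma t)%R <= L^-1)%E.
Proof.
move=> g0 cg cx He L1 K.
have [r [-> r0 r1 rL]] : exists r : R, [/\ (L^-1 = r%:E)%E, 0 <= r, r < 1 &
    forall theta : R, r < theta -> (theta^-1%:E < L)%E].
  move: L L1 {K} => [l| |//].
    rewrite lte_fin => l1; exists l^-1; split.
    - by rewrite inver gt_eqF//; lra.
    - by rewrite invr_ge0; lra.
    - by rewrite invf_lt1//; lra.
    - move=> th lth; rewrite lte_fin -[ltRHS]invrK ltf_pV2 ?posrE//.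
        by apply: lt_trans lth; rewrite invr_gt0; lra.
      by rewrite invr_gt0; lra.
  by move=> _; exists 0; split=> [||//|th _]; rewrite ?invey ?ltr01 ?ltry.
have x_le : \forall t \near +oo, `|x t| <= 1 * gamma t.
  under eq_near do rewrite mul1r.
  have th0 : 0 < (r + 1) / 2 by lra.
  have th1 : (r + 1) / 2 < 1 by lra.
  apply: (dominated_le_gamma g0 cg cx _ th0 th1 He).
  by apply: K => //; apply: rL; lra.
apply/lee_addgt0Pr => e e0; rewrite -EFinD; apply: limsup_ratio_le => //.
have e20 : 0 < e / 2 by lra.
have -> : r + e = 1 * (r + e / 2) + e / 2 by field.
apply: dominated_contract g0 _ (He _ e20) _ x_le => //.
by apply: K; [lra|apply: rL; lra].
Qed.

(** Otherwise |x| <= S gamma eventually, self-domination with theta = 1 gives |x - H| <= S gamma,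
    and |H| <= 2 S gamma contradicts the infinite upper limit of |H| / gamma. *)
Lemma limsup_ratio_pinfty {R : realType} {x H gamma : R -> R} :
  (forall t : R, 0 < t -> 0 < gamma t) ->
  self_dominated x H gamma 1 ->
  limsup_pinfty (fun t => `|H t| / gamma t) = +oo%E ->
  limsup_pinfty (fun t => `|x t| / gamma t) = +oo%E.
Proof.
move=> g0 K Hoo; apply/eqP; rewrite eq_le leey/= leNgt; apply/negP => xoo.
have [S S1 xS] : exists2 S : R, 1 <= S &
    (limsup_pinfty (fun t => `|x t| / gamma t)%R < S%:E)%E.
  move: xoo (limsup_ratio_ge0 x g0); case: (limsup_pinfty _) => [s| |]//.
  rewrite lee_fin => _ s0; exists (s + 1); first by lra.
  by rewrite lte_fin; lra.
have /eventually_ge[T0 hT0] := limsup_ratio_lt g0 xS.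
have [T [T0T hT]] : exists T, T0 <= T /\ \forall t \near +oo,
    forall S : R, 1 <= S ->
    (forall r : R, T <= r <= t -> `|x r| <= S * gamma r) ->
    `|x t - H t| <= S * (1 * gamma t).
  apply: (@filter_ex _ (+oo : set_system R)); near=> T; split; last by near: T; exact: K.
  by near: T; apply: nbhs_pinfty_ge; exact: num_real.
suff : (limsup_pinfty (fun t => `|H t| / gamma t)%R <= (2 * S)%:E)%E by rewrite Hoo.
apply: limsup_ratio_le => //; near=> t.
have Tt : T <= t by near: t; apply: nbhs_pinfty_ge; exact: num_real.
have : `|x t - H t| <= S * (1 * gamma t).
  have : forall S : R, 1 <= S ->
    (forall r : R, T <= r <= t -> `|x r| <= S * gamma r) ->
    `|x t - H t| <= S * (1 * gamma t) by near: t.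
  by apply=> // r /andP[Tr _]; apply: hT0; lra.
have : `|x t| <= S * gamma t by apply: hT0; lra.
have := ler_normB (x t) (x t - H t); rewrite opprB addrC subrK; lra.
Unshelve. all: by end_near. Qed.

Theorem theorem2p12 (R : realType)
    (mu : {measure set (measurableTypeR R) -> \bar R})
    (mu_gt0 : (0 < mu `[0%R, +oo[%classic)%E) (mu_fin : (mu `[0%R, +oo[%classic < +oo)%E)
    (f : R -> R) (f_cont : continuous f)
    (h : R -> R) (h_loc : L1_loc_Rplus h)
    (H : R -> R)
    (H_def : forall t : R, 0 <= t ->
       H t = \int[@lebesgue_measure R]_(s in `[0, t]) h s)
    (psi : R)
    (phi dphi : R -> R)
    (phi_C1 : is_C1_Rplus phi dphi)
    (phi_gt0 : forall x : R, 0 <= x -> 0 < phi x)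
    (dphi_gt0 : forall x : R, 0 <= x -> 0 < dphi x)
    (phi_infty : phi x @[x --> +oo] --> +oo)
    (dphi_noninc : forall x y : R, 0 <= x -> x <= y -> dphi y <= dphi x)
    (dphi_0 : dphi x @[x --> +oo] --> (0 : R))
    (f_phi : f x / phi x @[x --> +oo] --> (1 : R))
    (absf_phi : `|f x| / phi `|x| @[x --> norm_infty_nbhs R] --> (1 : R))
    (gammap gammam : R -> R)
    (gammap_growth : growth_function gammap)
    (gammam_growth : growth_function gammam)
    (H_gammap : limsup_pinfty (fun t => `|H t| / gammap t) = 0%E)
    (H_gammam : limsup_pinfty (fun t => `|H t| / gammam t) = +oo%E)
    (x : R -> R) (x_sol : is_solution mu f h psi x) :
  (forall Lp Lm : \bar R,
     is_Lf mu f gammap Lp -> is_Lf mu f gammam Lm ->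
     (1 < Lp)%E -> (1 < Lm)%E ->
     [/\ (0 <= limsup_pinfty (fun t => `|x t| / gammap t)%R)%E,
         (limsup_pinfty (fun t => `|x t| / gammap t)%R <= Lp^-1)%E
       & limsup_pinfty (fun t => `|x t| / gammam t) = +oo%E]) /\
  (is_Lf mu f gammap +oo%E -> is_Lf mu f gammam +oo%E ->
     `|x t| / gammap t @[t --> +oo] --> (0 : R) /\
     limsup_pinfty (fun t => `|x t| / gammam t) = +oo%E).
Proof.
have M0 : 0 < total_mass mu by apply: fine_gt0; rewrite mu_gt0.
have foo := cvg_ratio_pinfty f_phi phi_infty.
have fC := sublinear_comparison f_cont phi_C1 phi_gt0 dphi_gt0 dphi_noninc f_phi absf_phi.
have cx t : 0 <= t -> {within `[0, t], continuous x} by exact: solution_continuous x_sol.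
have K gamma L : growth_function gamma -> is_Lf mu f gamma L -> (1 < L)%E ->
    forall theta : R, 0 < theta -> (theta^-1%:E < L)%E -> self_dominated x H gamma theta.
  move=> gg LfL L1 th.
  exact: solution_self_dominated M0 mu_fin f_cont foo h_loc H_def x_sol gg fC LfL L1.
have [cgp gp0 _ _] := gammap_growth.
have [_ gm0 _ _] := gammam_growth.
have He (e : R) : 0 < e -> \forall t \near +oo, `|H t| <= e * gammap t.
  by move=> e0; apply: limsup_ratio_lt => //; rewrite H_gammap lte_fin.
have up Lp : is_Lf mu f gammap Lp -> (1 < Lp)%E ->
    (limsup_pinfty (fun t => `|x t| / gammap t)%R <= Lp^-1)%E.
  move=> LfL L1; apply: (limsup_ratio_le_inve gp0 cgp cx He L1).
  exact: K gammap_growth LfL L1.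
have low Lm : is_Lf mu f gammam Lm -> (1 < Lm)%E ->
    limsup_pinfty (fun t => `|x t| / gammam t) = +oo%E.
  move=> LfL L1; apply: (limsup_ratio_pinfty gm0 _ H_gammam).
  (* For theta = 1 the condition 1 / theta < L is the hypothesis L > 1. *)
  by apply: (K _ _ gammam_growth LfL L1) => //; rewrite invr1.
split=> [Lp Lm LfLp LfLm Lp1 Lm1|LfLp LfLm].
  by split; [exact: limsup_ratio_ge0|exact: up|exact: low LfLm _].
split; last by apply: low LfLm _; rewrite ltry.
(* The inverse of +oo is 0, so the nonnegative ratio has upper limit at most 0 and therefore tends
   to 0. *)
have := up _ LfLp (ltry _); rewrite invey => xle.
apply/cvgr0Pnorm_lt => e e0; near=> t.
have t0 : 0 < t by near: t; apply: nbhs_pinfty_gt; exact: num_real.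
rewrite ger0_norm.
  by near: t; apply: limsup_pinfty_lt; apply: le_lt_trans xle _; rewrite lte_fin.
by rewrite divr_ge0// ltW// gp0.
Unshelve. all: by end_near. Qed.
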